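(* Let $w\ge 4$, $u=w-2$, $v=w-1$, and let $\sum$ denote the sum over positive integers $a,c$ with $a+c=w-1$. Then, as identities of polynomials in $T$, \begin{align*} \sum \zeta_*(a,1,c)&=\zeta_*(1,1,u)+\zeta(v,1)+\zeta(2,u),\\ \sum \zeta_*(a,\bar1,\bar c)&=\zeta_*(1,\bar1,\bar u)+\zeta(\bar1,\bar u,\bar1)-\zeta(\bar1,\bar u,1)+\zeta(v,\bar1)+\zeta(\bar2,\bar u),\\ \sum \zeta(\bar a,\bar1,c)&=\zeta(\bar1,\bar1,\bar u)+\zeta(2,\bar u)+\zeta(\bar v,\bar1),\\ \sum \zeta(\bar a,1,\bar c)&=\zeta(\bar1,u,1)+\zeta(\bar1,1,u)-\zeta(\bar1,u,\bar1)+\zeta(\bar v,1)+\zeta(\bar2,u),\\ \sum \zeta(\bar a,1,c)&=\zeta(\bar1,\bar1,\bar u)+2\zeta(\bar v,1)+\zeta(\bar1,v)-\zeta(\bar1,\bar v)-\zeta(\bar v,\bar1)-\zeta(\bar u,2)-\zeta(w),\\ \sum \zeta_*(a,1,\bar c)&=\zeta(\bar u,\bar1,\bar1)-\zeta(\bar u,\bar1,1)+\zeta_*(1,1,\bar u)-\zeta(\bar v,\bar1)+\zeta(v,\bar1)+2\zeta(\bar v,\bar1)-\zeta(\bar v,1)\\ &\quad-\zeta(\bar u,\bar2)+\zeta(2)\zeta(\bar u)-\zeta(\bar w),\\ \sum \zeta_*(a,\bar1,c)&=2\zeta(u,\bar1,\bar1)-2\zeta(u,\bar1,1)+\zeta(\bar1,1,u)+\zeta_*(1,\bar1,u)-\zeta(\bar1,\bar1,u)+\zeta(\bar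 v,\bar1)+\zeta(v,\bar1)\\ &\quad+\zeta(\bar1,v)-\zeta(\bar v,1)-\zeta(\bar1,\bar v)-\zeta(2,u)-2\zeta(u,\bar2)-\zeta(\bar w)-\zeta(w),\\ \sum \zeta(\bar a,\bar1,\bar c)&=3\zeta(u,\bar1,1)-3\zeta(u,\bar1,\bar1)+\zeta(\bar1,\bar1,u)+2\zeta(\bar v,1)-\zeta(\bar v,\bar1)+\zeta(u,\bar2)+\zeta(2,u)-\zeta(u,2). \end{align*}
   Context: Euler sums: for positive integers $s_j$ and $z_j\in\{\pm1\}$, $\zeta(s_1,\dots,s_d;z_1,\dots,z_d)=\sum_{n_1>\dots>n_d>0}\frac{z_1^{n_1}\cdots z_d^{n_d}}{n_1^{s_1}\cdots n_d^{s_d}}$, convergent iff $(s_1,z_1)\ne(1,1)$; a bar over the $j$-th argument means $z_j=-1$, no bar means $z_j=1$. Stuffle regularization: the truncated sum $\zeta^{(M)}$ (restricted to $M\ge n_1$) has, as $M\to\infty$, an expansion $P(\log M+\gamma)+o(1)$ with $P$ a polynomial ($\gamma$ Euler's constant); $\zeta_*:=P(T)\in\mathbb{R}[T]$, which equals the Euler sum for convergent indices. *)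

(* Defs.v *)
From mathcomp Require Import all_boot all_order all_algebra.
From mathcomp Require Import all_classical all_reals all_analysis.
Set Implicit Arguments. Unset Strict Implicit. Unset Printing Implicit Defensive.
Import Order.TTheory GRing.Theory Num.Theory numFieldNormedType.Exports.
Local Open Scope ring_scope.
Local Open Scope classical_set_scope.

(* An Euler-sum index: a list of pairs (s_j, barred_j); barred_j = true means z_j = -1. *)
Definition eidx := seq (nat * bool).
Definition unb (k : nat) : nat * bool := (k, false).
Definition bar (k : nat) : nat * bool := (k, true).

Section EulerSums.
Variable R : realType.

Definition zsign (b : bool) (n : nat) : R := if b then (-1) ^+ n else 1.

Fixpoint ztrunc (s : eidx) (M : nat) : R :=
  match s with
  | [::] => 1
  | (k, b) :: t => \sum_(1 <= n < M.+1) zsign b n / (n%:R ^+ k) * ztrunc t n.-1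
  end.

(* The Euler sum (for convergent indices): limit of the truncated sums. *)
Definition zeta (s : eidx) : R := limn (ztrunc s).

Definition euler_gamma : R :=
  limn (fun n : nat => \sum_(1 <= k < n.+1) (k%:R)^-1 - ln (n%:R)).

(* P is a stuffle regularization of s: zeta^(M)(s) = P(log M + gamma) + o(1). *)
Definition is_zreg (s : eidx) (P : {poly R}) : Prop :=
  (fun M : nat => ztrunc s M - P.[ln (M%:R) + euler_gamma]) @ \oo --> (0 : R).

Definition zstar (s : eidx) : {poly R} := xget 0 (is_zreg s).

End EulerSums.

Arguments ztrunc {R} s M.
Arguments zeta {R} s.
Arguments zstar {R} s.

(* Main.v *)
Require Import Defs.
From mathcomp Require Import all_boot all_order all_algebra.
From mathcomp Require Import all_classical all_reals all_analysis.
From mathcomp Require Import ring lra zify.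
From mathcomp Require polyrcf.
Set Implicit Arguments. Unset Strict Implicit. Unset Printing Implicit Defensive.
Import Order.TTheory GRing.Theory Num.Theory numFieldNormedType.Exports.
Local Open Scope ring_scope.

(** In the regularized identities the divergent term [a = 1] occurs on both sides,
    so only convergent sums matter. Write [z1, z2, z3] for the signs of a sum
    [zeta(a, 1, c)]. Summing the geometric progression
    [sum_(a + c = u + 1) 1/(n^a k^c) = (k^-u - n^-u)/(n - k)] turns the left-hand
    side, truncated at [M], into the difference of two sums over [M >= n > m > k],
    with summands [z1^n z2^m z3^k / (m (n - k) k^u)] and
    [z1^n z2^m z3^k / (m (n - k) n^u)]. Partial fractions evaluate the second one
    exactly in truncated Euler sums. In the first one, the terms [m >= n] complete it
    to the product [zeta(1) zeta(1, u)], and are themselves, by the reflection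
    [n -> m + k - n] and partial fractions, a product minus a truncated triple sum.
    The products are over regions such as [q + k <= M] instead of the square; the
    discrepancy is [O((log M)^2 / M)], except for the corner
    [sum_(r, s <= M < r + s) x^r y^s / (r s)], which is exactly [zeta^(M)(2)] for
    [x = y = 1] and tends to [0] for [x = -1]. After stuffling all products, the
    difference of the two sides of each identity is [0] or [zeta(u)] times a
    vanishing corner. *)

Local Arguments ztrunc {R} s M : simpl never.

(** * Truncated Euler sums and their products *)

Section Algebra.
Variable R : realType.
Implicit Types (a b c : bool) (k m n u M : nat) (x y z : nat * bool).
Notation sg := (@zsign R).
Notation Z := (@ztrunc R).

Lemma zsign_pm b n : {sg b n = 1} + {sg b n = -1}.
Proof.
rewrite /zsign; case: b; last by left.
by rewrite -signr_odd; case: odd; [right | left].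
Qed.

Lemma zsign_sqr b n : sg b n * sg b n = 1.
Proof. by case: (zsign_pm b n) => ->; ring. Qed.

Lemma norm_zsign b n : `|sg b n| = 1.
Proof. by case: (zsign_pm b n) => ->; rewrite ?normrN normr1. Qed.

Lemma zsign_addb b c n : sg (b (+) c) n = sg b n * sg c n.
Proof.
case: b; case: c; rewrite /zsign /= ?mul1r ?mulr1 //.
by rewrite -exprMn mulrNN mulr1 expr1n.
Qed.

Lemma zsignD b n k : sg b (n + k) = sg b n * sg b k.
Proof. by case: b; rewrite /zsign /= ?mulr1 // exprD. Qed.

Lemma zsignB b n k : (k <= n)%N -> sg b (n - k) = sg b n * sg b k.
Proof. by move=> kn; rewrite -{2}(subnK kn) zsignD -mulrA zsign_sqr mulr1. Qed.

Definition zterm x n : R := sg x.2 n / n%:R ^+ x.1.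

Definition letter_add x y : nat * bool := ((x.1 + y.1)%N, x.2 (+) y.2).

Lemma zterm_add x y n : zterm (letter_add x y) n = zterm x n * zterm y n.
Proof. by rewrite /zterm zsign_addb exprD invfM mulrACA. Qed.

Lemma ztrunc_consE x t M :
  Z (x :: t) M = \sum_(1 <= n < M.+1) zterm x n * Z t n.-1.
Proof. by case: x. Qed.

Lemma ztrunc_cons0 x t : Z (x :: t) 0 = 0.
Proof. by rewrite ztrunc_consE big_geq. Qed.

Lemma ztrunc_consS x t M : Z (x :: t) M.+1 = Z (x :: t) M + zterm x M.+1 * Z t M.
Proof. by rewrite !ztrunc_consE big_nat_recr. Qed.

Lemma ztrunc1E x M : Z [:: x] M = \sum_(1 <= n < M.+1) zterm x n.
Proof. by rewrite ztrunc_consE; apply: eq_bigr => n _; rewrite mulr1. Qed.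

Lemma ztrunc2E x y M :
  Z [:: x; y] M = \sum_(1 <= n < M.+1) \sum_(1 <= k < n) zterm x n * zterm y k.
Proof.
rewrite ztrunc_consE; apply: eq_big_nat => n /andP[n1 _].
by rewrite ztrunc1E prednK // mulr_sumr.
Qed.

Lemma ztrunc3E x y z M :
  Z [:: x; y; z] M = \sum_(1 <= n < M.+1) \sum_(1 <= m < n) \sum_(1 <= k < m)
    zterm x n * zterm y m * zterm z k.
Proof.
rewrite ztrunc_consE; apply: eq_big_nat => n /andP[n1 _].
rewrite ztrunc2E prednK // mulr_sumr; apply: eq_bigr => m _.
by rewrite mulr_sumr; apply: eq_bigr => k _; rewrite mulrA.
Qed.

(** Discrete product rule: terms of the product are grouped by the larger [n] of the two leading
    indices, which comes from the first factor only, from the second only, or from both. This is the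
    quasi-shuffle recursion. *)
Lemma ztrunc_mul_cons x y s t M :
  Z (x :: s) M * Z (y :: t) M =
    \sum_(1 <= n < M.+1) (zterm x n * (Z s n.-1 * Z (y :: t) n.-1)
      + zterm y n * (Z (x :: s) n.-1 * Z t n.-1)
      + zterm (letter_add x y) n * (Z s n.-1 * Z t n.-1)).
Proof.
elim: M => [|M IH]; first by rewrite !ztrunc_cons0 big_geq // mul0r.
by rewrite !ztrunc_consS big_nat_recr //= -IH zterm_add; ring.
Qed.

Lemma stuffle11 x y M :
  Z [:: x] M * Z [:: y] M = Z [:: x; y] M + Z [:: y; x] M + Z [:: letter_add x y] M.
Proof.
rewrite ztrunc_mul_cons !big_split /= !ztrunc_consE; congr (_ + _ + _);
  by apply: eq_bigr => n _; rewrite ?mul1r ?mulr1.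
Qed.

Lemma stuffle12 x y z M :
  Z [:: x] M * Z [:: y; z] M = Z [:: x; y; z] M + Z [:: y; x; z] M
    + Z [:: y; z; x] M + Z [:: letter_add x y; z] M + Z [:: y; letter_add x z] M.
Proof.
rewrite ztrunc_mul_cons !big_split /=.
(* The terms led by [y] still contain a product of two depth-one sums, which [stuffle11]
   resolves. *)
rewrite (_ : \sum_(_ <= i < _) zterm y i * _ =
    Z [:: y; x; z] M + Z [:: y; z; x] M + Z [:: y; letter_add x z] M); last first.
  rewrite !(ztrunc_consE y) -!big_split /=; apply: eq_bigr => n _.
  by rewrite -/ztrunc stuffle11; ring.
have -> : \sum_(1 <= i < M.+1) zterm x i * (1 * Z [:: y; z] i.-1) = Z [:: x; y; z] M.
  by rewrite (ztrunc_consE x); apply: eq_bigr => n _; rewrite mul1r.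
have -> : \sum_(1 <= i < M.+1) zterm (letter_add x y) i * (1 * Z [:: z] i.-1)
    = Z [:: letter_add x y; z] M.
  by rewrite (ztrunc_consE (letter_add x y)); apply: eq_bigr => n _; rewrite mul1r.
by ring.
Qed.

Lemma sum_triangle_swap (F : nat -> nat -> R) M :
  \sum_(1 <= n < M.+1) \sum_(1 <= k < n) F n k =
  \sum_(1 <= k < M.+1) \sum_(k.+1 <= n < M.+1) F n k.
Proof.
elim: M => [|M IH]; first by rewrite !big_geq.
rewrite big_nat_recr //= IH [RHS]big_nat_recr //= [X in _ = _ + X]big_geq // addr0.
rewrite -big_split; apply: eq_big_nat => k /andP[k1 kM] /=.
by rewrite [RHS]big_nat_recr.
Qed.

(** The substitution [q = n - k] turns the triangle [k < n <= M] into the region [k + q <= M], a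
    product region up to its corner. *)
Lemma sum_triangle_conv (F : nat -> nat -> R) M :
  \sum_(1 <= n < M.+1) \sum_(1 <= k < n) F k (n - k)%N =
  \sum_(1 <= k < M.+1) \sum_(1 <= q < (M - k).+1) F k q.
Proof.
rewrite sum_triangle_swap; apply: eq_big_nat => k /andP[k1 kM].
rewrite -add1n big_addn -subSn //; apply: eq_bigr => q _.
by rewrite addnK.
Qed.

(** Reflecting the middle index inside the interval from [k] to [n] exchanges the gaps [n - m] and
    [m - k]. *)
Lemma sum_mid_rev (F : nat -> nat -> nat -> R) M :
  \sum_(1 <= n < M.+1) \sum_(1 <= m < n) \sum_(1 <= k < m) F n m k =
  \sum_(1 <= n < M.+1) \sum_(1 <= m < n) \sum_(1 <= k < m) F n (n + k - m)%N k.
Proof.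
apply: eq_big_nat => -[//|n] _; rewrite !sum_triangle_swap.
apply: eq_big_nat => k _; rewrite big_nat_rev /=; apply: eq_bigr => m _.
by congr (F _ _ _); lia.
Qed.

(** For each [k], the square of pairs [n, m] above [k] is cut along its diagonal. *)
Lemma sum_square_split (F : nat -> nat -> nat -> R) M :
  \sum_(1 <= k < M.+1) \sum_(k.+1 <= n < M.+1) \sum_(k.+1 <= m < M.+1) F n m k =
  \sum_(1 <= n < M.+1) \sum_(1 <= m < n) \sum_(1 <= k < m) F n m k
  + \sum_(1 <= m < M.+1) \sum_(1 <= n < m) \sum_(1 <= k < n) F n m k
  + \sum_(1 <= n < M.+1) \sum_(1 <= k < n) F n n k.
Proof.
elim: M => [|M IH]; first by rewrite !big_geq // !addr0.
rewrite [LHS]big_nat_recr //= [X in _ + X]big_geq // addr0.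
rewrite ![in RHS](big_nat_recr M.+1) //=.
transitivity (\sum_(1 <= k < M.+1) (\sum_(k.+1 <= n < M.+1) \sum_(k.+1 <= m < M.+1) F n m k
   + \sum_(k.+1 <= n < M.+1) F n M.+1 k + \sum_(k.+1 <= m < M.+1) F M.+1 m k
   + F M.+1 M.+1 k)).
  apply: eq_big_nat => k /andP[k1 kM]; rewrite big_nat_recr //=.
  rewrite [X in _ + X = _]big_nat_recr //= addrA; congr (_ + _ + _).
  by rewrite -big_split; apply: eq_big_nat => n _; rewrite big_nat_recr.
rewrite !big_split /= IH !sum_triangle_swap.
rewrite -(sum_triangle_swap (fun n k => F n M.+1 k)).
rewrite -(sum_triangle_swap (fun m k => F M.+1 m k)).
by ring.
Qed.

(** As [(n - k) / (n k) = 1/k - 1/n], clearing the denominator [n - k] leaves the factorization of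
    [x^u - y^u] at [x = 1/k], [y = 1/n]. *)
Lemma sum_geometric_pair (u n k : nat) : (0 < k)%N -> (k < n)%N ->
  \sum_(1 <= i < u.+1) (n%:R ^+ i)^-1 * (k%:R ^+ (u.+1 - i))^-1 =
  ((k%:R ^+ u)^-1 - (n%:R ^+ u)^-1) / (n%:R - k%:R) :> R.
Proof.
move=> k0 kn.
have k0' : k%:R != 0 :> R by rewrite pnatr_eq0 -lt0n.
have n0' : n%:R != 0 :> R by rewrite pnatr_eq0 -lt0n (leq_trans _ kn).
have nk : n%:R - k%:R != 0 :> R by rewrite subr_eq0 eqr_nat; lia.
apply: (mulIf nk); rewrite divfK //.
rewrite -!exprVn subrXX -(big_mkord predT (fun i => k%:R^-1 ^+ (u.-1 - i) * n%:R^-1 ^+ i)).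
rewrite big_add1 /= mulr_suml mulr_sumr; apply: eq_big_nat => i /andP[_ iu].
rewrite -!exprVn (_ : u.+1 - i.+1 = (u.-1 - i).+1)%N; last by lia.
by rewrite !exprS; set A := _ ^+ i; set B := _ ^+ (_ - i); field; apply/andP.
Qed.

(** Cauchy product coefficient: the coefficient of [t^n] in the product of the power series with
    coefficients [sg a r / r] and [sg b s / s]. *)
Definition zconv a b n : R :=
  \sum_(1 <= s < n) sg b s * sg a (n - s) / (s%:R * (n - s)%:R).

Lemma zconvE a b n : zconv a b n = (sg a n + sg b n) / n%:R * Z [:: (1, a (+) b)%N] n.-1.
Proof.
case: n => [|n]; first by rewrite /zconv ztrunc_cons0 big_geq // mulr0.
rewrite /zconv ztrunc1E /=.
(* Partial fractions [1/(s (N - s)) = (1/s + 1/(N - s)) / N] with [N = n.+1]; the second half is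
   then reversed by [s -> N - s]. *)
transitivity (\sum_(1 <= s < n.+1) sg b s * sg a (n.+1 - s) / (n.+1%:R * s%:R)
   + \sum_(1 <= s < n.+1) sg b s * sg a (n.+1 - s) / (n.+1%:R * (n.+1 - s)%:R)).
  rewrite -big_split; apply: eq_big_nat => s /andP[s1 sn] /=.
  rewrite natrB; last by lia.
  have s0 : s%:R != 0 :> R by rewrite pnatr_eq0 -lt0n.
  have ns0 : n.+1%:R - s%:R != 0 :> R by rewrite subr_eq0 eqr_nat; lia.
  have n0 : n.+1%:R != 0 :> R by rewrite pnatr_eq0.
  move: (n.+1%:R : R) ns0 n0 => N ns0 n0.
  by set S := sg b s * _; field; rewrite ns0 n0 s0.
rewrite [X in _ + X]big_nat_rev /= -big_split /= mulr_sumr.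
apply: eq_big_nat => s /andP[s1 sn].
rewrite (_ : 1 + n.+1 - s.+1 = n.+1 - s)%N; last by lia.
rewrite subKn; last by lia.
rewrite !zsignB; try by lia.
rewrite /zterm /= zsign_addb.
rewrite expr1 !invfM; ring.
Qed.

(* The part [r + s > M] of the square [r, s <= M]: the defect between
   the stuffle and the shuffle product of two truncated sums of weight one. *)
Definition zcorner a b M : R :=
  \sum_(1 <= s < M.+1) sg b s / s%:R * \sum_((M - s).+1 <= r < M.+1) sg a r / r%:R.

Lemma zcorner_conv a b M :
  zcorner a b M = Z [:: (1, a)%N] M * Z [:: (1, b)%N] M - \sum_(1 <= n < M.+1) zconv a b n.
Proof.
rewrite /zconv.
have -> : \sum_(1 <= n < M.+1) \sum_(1 <= s < n) sg b s * sg a (n - s) / (s%:R * (n - s)%:R)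
  = \sum_(1 <= s < M.+1) \sum_(1 <= r < (M - s).+1) sg b s * sg a r / (s%:R * r%:R).
  exact: (sum_triangle_conv (fun s r => sg b s * sg a r / (s%:R * r%:R))).
rewrite !ztrunc1E mulr_sumr -sumrB; apply: eq_big_nat => s /andP[s1 sM].
rewrite (@big_cat_nat _ _ _ (M - s).+1 1 M.+1) //=; last by lia.
rewrite mulrDl /zterm /= !expr1.
have -> : \sum_(1 <= r < (M - s).+1) sg b s * sg a r / (s%:R * r%:R) =
  (\sum_(1 <= r < (M - s).+1) sg a r / r%:R) * (sg b s / s%:R).
  by rewrite mulr_suml; apply: eq_bigr => r _; rewrite invfM; ring.
rewrite [X in _ = X + _ - _](_ : _ =
    (\sum_(1 <= r < (M - s).+1) sg a r / r%:R) * (sg b s / s%:R)); last first.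
  by congr (_ * _); apply: eq_bigr => r _; rewrite expr1.
by rewrite addrAC subrr add0r mulrC; congr (_ * _).
Qed.

Lemma sum_zconv a b M : \sum_(1 <= n < M.+1) zconv a b n =
  Z [:: (1, a); (1, a (+) b)]%N M + Z [:: (1, b); (1, a (+) b)]%N M.
Proof.
rewrite !(ztrunc_consE (1%N, _) [:: _]) -big_split; apply: eq_bigr => n _ /=.
by rewrite zconvE /zterm /= expr1; ring.
Qed.

(** Stuffle product minus shuffle product. With both letters unbarred the double sums cancel,
    leaving the truncated [zeta(2)]. *)
Lemma zcornerE a b M : zcorner a b M =
  Z [:: (1, a); (1, b)]%N M + Z [:: (1, b); (1, a)]%N M + Z [:: (2, a (+) b)%N] M
  - Z [:: (1, a); (1, a (+) b)]%N M - Z [:: (1, b); (1, a (+) b)]%N M.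
Proof. by rewrite zcorner_conv stuffle11 sum_zconv /letter_add /=; ring. Qed.

End Algebra.

(** * Convergence *)

Section Convergence.
Local Open Scope classical_set_scope.
Variable R : realType.
Implicit Types (a b c : bool) (d k m n u M : nat) (x y z : nat * bool).
Notation Z := (@ztrunc R).
Notation zt := (@zterm R).
Notation ones d := (nseq d (1%N, false)).

Lemma norm_zterm_le x k n : (k <= x.1)%N -> (0 < n)%N -> `|zt x n| <= (n%:R ^+ k)^-1.
Proof.
move=> kx n0; rewrite /zterm normrM norm_zsign mul1r ger0_norm ?invr_ge0 ?exprn_ge0 //.
have n1 : 1 <= n%:R :> R by rewrite ler1n.
by rewrite lef_pV2 ?qualifE /= ?exprn_gt0 ?ltr0n // ler_weXn2l.
Qed.

Lemma zterm_unbarred_ge0 k n : 0 <= zt (k, false) n.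
Proof. by rewrite /zterm mul1r invr_ge0 exprn_ge0. Qed.

Lemma ztrunc_ones_ge0 d M : 0 <= Z (ones d) M.
Proof.
elim: d M => [|d IH] M; first exact: ler01.
rewrite ztrunc_consE sumr_ge0 // => n _.
by rewrite mulr_ge0 ?zterm_unbarred_ge0.
Qed.

Lemma norm_ztrunc_le s M : all (fun x => 0 < x.1)%N s -> `|Z s M| <= Z (ones (size s)) M.
Proof.
elim: s M => [|x s IH] M /=; first by rewrite normr1.
case/andP => x1 s1; rewrite !ztrunc_consE (le_trans (ler_norm_sum _ _ _)) //.
apply: ler_sum_nat => n /andP[n1 _]; rewrite normrM ler_pM // ?IH //.
by rewrite (le_trans (norm_zterm_le x1 n1)) // /zterm mul1r.
Qed.

(** Induction on depth without logarithms: at depth [d.+1] the quotient is bounded by the Cesaro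
    mean of the quotients at depth [d]. *)
Lemma ztrunc_ones_div_cvg0 d : (fun n => Z (ones d) n / n.+1%:R) @ \oo --> (0 : R).
Proof.
elim: d => [|d IH].
  apply: cvg_trans (@cvg_harmonic R); apply: near_eq_cvg; near=> n.
  by rewrite /harmonic /= mul1r.
have := cesaro IH; apply: squeeze_cvgr; last exact: cvg_cst.
near=> n; rewrite divr_ge0 ?ztrunc_ones_ge0 //=.
rewrite mulrC ler_pM2l ?invr_gt0 ?ltr0n // seriesEnat /=.
rewrite ztrunc_consE big_add1 /= [leRHS]big_nat_recr //= -[leLHS]addr0 lerD //.
  apply: ler_sum_nat => m _; rewrite /zterm mul1r mulrC //.
by rewrite divr_ge0 ?ztrunc_ones_ge0.
Unshelve. all: by end_near. Qed.

(** Summation by parts: [1/(N+1)^2 <= 1/N - 1/(N+1)], so moving the difference onto the inner sum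
    trades the letters [2, 1] for the single letter [2], with boundary term [Z (1 :: t) M / M]. *)
Lemma ztrunc2_step t M : (forall n, 0 <= Z t n) ->
  Z [:: (2, false), (1, false) & t]%N M + Z ((1, false)%N :: t) M / M%:R
    <= Z ((2, false)%N :: t) M.
Proof.
move=> t0; elim: M => [|M IH]; first by rewrite !ztrunc_cons0 mul0r addr0.
have G0 : 0 <= Z ((1, false)%N :: t) M.
  by rewrite ztrunc_consE sumr_ge0 // => n _; rewrite mulr_ge0 ?zterm_unbarred_ge0.
rewrite !ztrunc_consS; set G := Z ((1, false)%N :: t) M in IH G0 *.
set T := Z t M; move: IH.
set P := Z _ M; set Q := Z _ M; move=> IH.
(* The step from 0 to 1 is separate, because there [1/N] is the default value 0 and the inequality
   above fails. *)
case: M @G @T @P @Q G0 IH => [|M] G T P Q G0 IH.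
  have GE : G = 0 by rewrite /G ztrunc_cons0.
  have -> : Q = 0 by rewrite /Q ztrunc_cons0.
  have -> : P = 0 by rewrite /P ztrunc_cons0.
  by rewrite GE /zterm /zsign /= !expr1n !divr1 mulr0 !add0r.
rewrite /zterm /= !mul1r.
have N0 : 0 < M.+1%:R :> R by rewrite ltr0n.
have E : M.+2%:R = M.+1%:R + 1 :> R by rewrite -natr1.
rewrite E; move: (M.+1%:R : R) N0 IH => N N0 IH.
have N1 : 0 < N + 1 by lra.
have key : ((N + 1) ^+ 2)^-1 * G + G / (N + 1) <= G / N.
  rewrite -subr_ge0 (_ : _ - _ = G / (N * (N + 1) ^+ 2)).
    by rewrite divr_ge0 // mulr_ge0 ?ltW // exprn_gt0.
  by field; rewrite !gt_eqF.
have -> : ((N + 1) ^+ 2)^-1 * T = (N + 1)^-1 * T / (N + 1) by field; rewrite gt_eqF.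
rewrite mulrDl; move: key IH; set A := _^-1 * T / _; set B := _ * G.
by set C := G / (N + 1); set D := G / N; lra.
Qed.

Lemma ztrunc2_ones_le d M : Z ((2, false)%N :: ones d) M <= 2.
Proof.
elim: d => [|d IH]; last first.
  apply: le_trans IH; apply: le_trans (ztrunc2_step _ (ztrunc_ones_ge0 d)).
  by rewrite lerDl divr_ge0 // (ztrunc_ones_ge0 d.+1).
(* The sharper bound telescopes; at [M = 0] it reads [0 <= 2], as the inverse of 0 is 0. *)
suff : Z [:: (2, false)%N] M <= 2 - M%:R^-1.
  by move=> h; apply: le_trans h _; rewrite gerBl invr_ge0.
elim: M => [|M IH]; first by rewrite ztrunc_cons0 invr0 subr0.
rewrite ztrunc_consS [Z [::] M](_ : _ = 1) // mulr1 /zterm /= mul1r.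
case: M IH => [|M] IH; first by rewrite ztrunc_cons0 expr1n invr1; lra.
have N0 : 0 < M.+1%:R :> R by rewrite ltr0n.
have E : M.+2%:R = M.+1%:R + 1 :> R by rewrite -natr1.
rewrite E; move: (Z _ _) (M.+1%:R : R) N0 IH => z N N0 IH.
have key : ((N + 1) ^+ 2)^-1 + (N + 1)^-1 <= N^-1.
  rewrite -subr_ge0 (_ : _ - _ = (N * (N + 1) ^+ 2)^-1).
    by rewrite invr_ge0 mulr_ge0 ?ltW // exprn_gt0 //; lra.
  by field; rewrite !gt_eqF //; lra.
by move: key IH; set A := _^-1; set B := _^-1; set C := N^-1; lra.
Qed.

Lemma cvg_series_ones2 d : cvgn (series (fun n => zt (2, false)%N n.+1 * Z (ones d) n)).
Proof.
have E M : series (fun n => zt (2, false)%N n.+1 * Z (ones d) n) M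
    = Z ((2, false)%N :: ones d) M.
  by rewrite ztrunc_consE seriesEnat big_add1.
apply: nondecreasing_is_cvgn.
  apply/nondecreasing_seqP => n; rewrite !E ztrunc_consS lerDl.
  by rewrite mulr_ge0 ?zterm_unbarred_ge0 ?ztrunc_ones_ge0.
by exists 2 => _ [M _ <-]; rewrite E ztrunc2_ones_le.
Qed.

(** Two majorants of possibly different depths are allowed because a leading barred 1 produces a sum
    of two such bounds. *)
Lemma cvg_series_dominated (f : nat -> R) d e :
  (forall n, `|f n| <= zt (2, false)%N n.+1 * Z (ones d) n
                       + zt (2, false)%N n.+1 * Z (ones e) n) ->
  cvgn (series f).
Proof.
move=> fle; apply: normed_cvg.
apply: series_le_cvg (is_cvg_seriesD (@cvg_series_ones2 d) (@cvg_series_ones2 e)).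
- by move=> n /=.
- by move=> n; rewrite addr_ge0 // mulr_ge0 ?zterm_unbarred_ge0 ?ztrunc_ones_ge0.
- exact: fle.
Qed.

Definition admissible (s : eidx) : bool :=
  all (fun x => 0 < x.1)%N s && (if s is x :: _ then (1 < x.1)%N || x.2 else true).

Lemma cvg_ztrunc_large x t : (1 < x.1)%N -> all (fun x => 0 < x.1)%N t -> cvgn (Z (x :: t)).
Proof.
move=> x2 t1.
have -> : Z (x :: t) = series (fun n => zt x n.+1 * Z t n).
  by apply/funext => M; rewrite ztrunc_consE seriesEnat big_add1.
apply: (@cvg_series_dominated _ (size t) 0) => n.
rewrite normrM -[leLHS]addr0 lerD //.
  rewrite ler_pM ?norm_ztrunc_le //.
  by rewrite (le_trans (norm_zterm_le x2 _)) // /zterm mul1r.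
by rewrite mulr_ge0 ?zterm_unbarred_ge0 // ler01.
Qed.

Lemma norm_ztrunc_increment t n : all (fun x => 0 < x.1)%N t ->
  `|Z t n.+1 - Z t n| <= n.+1%:R^-1 * Z (ones (size t).-1) n.
Proof.
case: t => [_|x t /andP[x1 t1]].
  by rewrite subrr normr0 mulr_ge0 ?invr_ge0 // ztrunc_ones_ge0.
rewrite ztrunc_consS addrAC subrr add0r normrM ler_pM ?norm_ztrunc_le //.
by rewrite (le_trans (norm_zterm_le x1 _)) // expr1.
Qed.

(** Averaging the alternating sum with its shift expresses it through the alternating sum of
    differences and boundary terms. The differences gain the extra decay needed for absolute
    convergence. *)
Lemma cvg_alternating (f : nat -> R) :
  f @ \oo --> (0 : R) -> cvgn (series (fun n => (-1) ^+ n * (f n - f n.+1))) ->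
  cvgn (series (fun n => (-1) ^+ n * f n)).
Proof.
move=> f0 cf.
have -> : series (fun n => (-1) ^+ n * f n) =
  (fun M => 2^-1 * (series (fun n => (-1) ^+ n * (f n - f n.+1)) M - (-1) ^+ M * f M + f 0)).
  apply/funext => M; elim: M => [|M IH]; first by rewrite !seriesEnat /= !big_geq //; field.
  by rewrite !seriesSr IH exprS; field.
apply: is_cvgM; first exact: is_cvg_cst.
apply: is_cvgD; last exact: is_cvg_cst.
apply: is_cvgB => //; apply/cvg_ex; exists 0; apply/cvgr0Pnorm_lt => e e0.
move/cvgr0Pnorm_lt : f0 => /(_ e e0); apply: filterS => n.
by rewrite normrM normrX normrN1 expr1n mul1r.
Qed.

Lemma cvg_ztrunc_barred1 t : all (fun x => 0 < x.1)%N t -> cvgn (Z ((1, true)%N :: t)).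
Proof.
move=> t1; set f := fun n => Z t n / n.+1%:R.
have -> : Z ((1, true)%N :: t) = (fun M => - series (fun n => (-1) ^+ n * f n) M).
  apply/funext => M; rewrite ztrunc_consE seriesEnat big_add1 /= -sumrN.
  by apply: eq_bigr => n _; rewrite /zterm /zsign /f /= exprS; ring.
apply: is_cvgN; apply: cvg_alternating.
  apply/cvgr0Pnorm_lt => e e0.
  move/cvgr0Pnorm_lt : (ztrunc_ones_div_cvg0 (size t)) => /(_ e e0).
  apply: filterS => n; apply: le_lt_trans; rewrite !normrM ler_wpM2r //.
  by rewrite (le_trans (norm_ztrunc_le _ t1)) // ler_norm.
apply: (@cvg_series_dominated _ (size t) (size t).-1) => n.
rewrite normrM normrX normrN1 expr1n mul1r.
(* The difference of a quotient splits into the change of [1/(n+1)] and the increment of [Z t]; each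
   is at most an all-ones sum over [(n+1)^2], the second of depth [(size t).-1]. *)
have -> : f n - f n.+1 = (Z t n) * (n.+1%:R * n.+2%:R)^-1 - (Z t n.+1 - Z t n) / n.+2%:R.
  have E : n.+2%:R = n.+1%:R + 1 :> R by rewrite -natr1.
  have N0 : 0 < n.+1%:R :> R by rewrite ltr0n.
  by rewrite /f E; move: (n.+1%:R : R) N0 => N N0; field; rewrite !gt_eqF //; lra.
apply: (le_trans (ler_normB _ _)); rewrite !normrM !normfV !normrM !normr_nat /zterm /= !mul1r.
have N0 : 0 < n.+1%:R :> R by rewrite ltr0n.
have N1 : n.+2%:R^-1 <= n.+1%:R^-1 :> R by rewrite lef_pV2 ?qualifE /= ?ltr0n // ler_nat.
rewrite expr2 invfM lerD //.
  rewrite mulrC ler_pM ?mulr_ge0 ?invr_ge0 ?norm_ztrunc_le //.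
  by rewrite invfM ler_wpM2l // invr_ge0.
apply: le_trans (_ : (n.+1%:R^-1 * Z (ones (size t).-1) n) / n.+1%:R <= _).
  by rewrite ler_pM ?invr_ge0 ?norm_ztrunc_increment.
by rewrite mulrAC -invfM.
Qed.

Lemma cvg_ztrunc s : admissible s -> Z s @ \oo --> (zeta s : R).
Proof.
case: s => [_|x t] ; first by rewrite /zeta; apply: is_cvg_cst.
rewrite /admissible /= => /andP[/andP[x1 t1] /orP[x2|xb]].
  exact: cvg_ztrunc_large.
have [x2|xle] := ltnP 1 x.1; first exact: cvg_ztrunc_large.
case: x x1 xb xle => k b /= k1 -> k2; have -> : k = 1%N by lia.
exact: cvg_ztrunc_barred1.
Qed.

End Convergence.

(** * Uniqueness of the regularizing polynomial *)

Section Regularization.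
Variable R : realType.
Local Open Scope classical_set_scope.

Lemma eq_cvgn (f g : nat -> R) (l : R) : f =1 g -> f @ \oo --> l -> g @ \oo --> l.
Proof. by move=> /funext ->. Qed.

(** Up to sign the leading coefficient is positive; the polynomial then eventually stays above it,
    which excludes the limit 0. *)
Lemma poly_cvg0_eq0 (P : {poly R}) (x : nat -> R) :
  x @ \oo --> +oo -> (fun n => P.[x n]) @ \oo --> (0 : R) -> P = 0.
Proof.
move=> xoo; wlog lc : P / 0 < lead_coef P => [hw P0|].
  have [lc|lc|/esym/eqP] := ltgtP 0 (lead_coef P); first exact: hw.
    apply/eqP; rewrite -oppr_eq0; apply/eqP; apply: hw.
      by rewrite lead_coefN oppr_gt0.
    rewrite -oppr0; under eq_fun do rewrite hornerN.
    exact: cvgN.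
  by rewrite lead_coef_eq0 => /eqP.
move=> P0; have [B PB] := polyrcf.poly_pinfty_gt_lc lc.
exfalso; move/cvgr0Pnorm_lt : P0 => /(_ _ lc) P0.
near \oo => n.
have : `|P.[x n]| < lead_coef P by near: n.
have /PB lcP : B <= x n by near: n; move/cvgryPge : xoo; exact.
by rewrite ltNge (le_trans lcP) // ler_norm.
Unshelve. all: by end_near. Qed.

Lemma cvg_ln_nat_pinfty (c : R) : (fun M : nat => ln (M%:R : R) + c) @ \oo --> +oo.
Proof.
apply/cvgryPge => A; near=> M.
rewrite -lerBlDr -[leLHS]expRK ler_ln ?posrE ?expR_gt0 //.
  by near: M; apply: nbhs_infty_ger.
by near: M; apply: nbhs_infty_gtr.
Unshelve. all: by end_near. Qed.

(** [zstar] is a chosen regularization. The constant [zeta s] is one as well, and two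
    regularizations differ by a polynomial tending to 0 along [log M + gamma], hence by 0. *)
Lemma zstar_admissible s : admissible s -> zstar s = (zeta s : R)%:P.
Proof.
move=> /(@cvg_ztrunc R) cs.
have reg : is_zreg s (zeta s : R)%:P.
  rewrite /is_zreg; under eq_fun do rewrite hornerC.
  by rewrite -(subrr (zeta s)); apply: cvgB => //; exact: cvg_cst.
have : is_zreg s (zstar s : {poly R}) by apply: (xgetPex 0); exists (zeta s)%:P.
move=> reg'; apply/eqP; rewrite -subr_eq0; apply/eqP.
apply: (@poly_cvg0_eq0 _ (fun M => ln (M%:R : R) + euler_gamma R)).
  exact: cvg_ln_nat_pinfty.
rewrite -[X in _ --> X](subrr (0 : R)); apply: eq_cvgn (cvgB reg reg') => M /=.
by rewrite hornerD hornerN !hornerC !fctE !hornerC; ring.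
Qed.

End Regularization.

(** * Corner estimates *)

Section ErrorTerms.
Variable R : realType.
Local Open Scope classical_set_scope.
Implicit Types (a b c : bool) (d k m n u M : nat) (x y z : nat * bool).
Notation sg := (@zsign R).
Notation Z := (@ztrunc R).
Notation zt := (@zterm R).

Lemma cvg0_dominated (f g : nat -> R) :
  (forall n, `|f n| <= g n) -> g @ \oo --> (0 : R) -> f @ \oo --> (0 : R).
Proof.
move=> fg /cvgr0Pnorm_lt g0; apply/cvgr0Pnorm_lt => e /g0; apply: filterS => n.
by apply: le_lt_trans; rewrite (le_trans (fg n)) // ler_norm.
Qed.

Lemma cvg0_scale (c : R) (f : nat -> R) :
  f @ \oo --> (0 : R) -> (fun n => c * f n) @ \oo --> (0 : R).
Proof. by move=> f0; rewrite -[X in _ --> X](mulr0 c); exact: cvgM (cvg_cst c) f0. Qed.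

Lemma cvg0_add (f g : nat -> R) : f @ \oo --> (0 : R) -> g @ \oo --> (0 : R) ->
  (fun n => f n + g n) @ \oo --> (0 : R).
Proof. by move=> f0 g0; rewrite -[X in _ --> X](addr0 (0 : R)); exact: cvgD. Qed.

(** The terms lost when the range [r <= M] is cut to [r + k <= M]. *)
Definition ztail a k M : R := \sum_((M - k).+1 <= r < M.+1) sg a r / r%:R.

Lemma norm_ztail_le a k M : (k <= M)%N -> `|ztail a k M| <= k%:R / (M - k).+1%:R.
Proof.
move=> kM; apply: le_trans (ler_norm_sum _ _ _) _.
rewrite (le_trans (@ler_sum_nat _ _ _ _ (fun=> (M - k).+1%:R^-1) _)) //.
  move=> r /andP[r1 _]; rewrite normrM norm_zsign mul1r normfV normr_nat.
  by rewrite lef_pV2 ?qualifE /= ?ltr0n ?ler_nat //; lia.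
by rewrite sumr_const_nat mulr_natl (_ : (M.+1 - (M - k).+1 = k)%N) //; lia.
Qed.

(** Leibniz's argument: removing the first term leaves a tail of opposite sign, bounded by the next
    reciprocal. *)
Lemma alternating_tail_bounds d m :
  0 <= (-1 : R) ^+ m.+1 * (\sum_(m.+1 <= r < m.+1 + d) (-1) ^+ r / r%:R) <= m.+1%:R^-1.
Proof.
elim: d m => [|d IH] m; first by rewrite addn0 big_geq // mulr0 lexx invr_ge0 ler0n.
rewrite big_ltn; last by lia.
have := IH m.+1; rewrite (_ : (m.+2 + d = m.+1 + d.+1)%N); last by lia.
set S := \sum_(_ <= _ < _) _; rewrite [(-1) ^+ m.+2]exprS => /andP[S0 S1].
have sq : (-1) ^+ m.+1 * (-1) ^+ m.+1 = 1 :> R by rewrite -exprMn mulrNN mulr1 expr1n.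
have N1 : m.+2%:R^-1 <= m.+1%:R^-1 :> R by rewrite lef_pV2 ?qualifE /= ?ltr0n // ler_nat.
rewrite mulrDr mulrA sq mul1r; move: S0 S1 N1; rewrite mulN1r mulNr.
move: (_ * S : R) (m.+1%:R^-1 : R) (m.+2%:R^-1 : R) => A p q *.
by apply/andP; split; lra.
Qed.

Lemma norm_ztail_barred_le k M : (k <= M)%N -> `|ztail true k M| <= (M - k).+1%:R^-1.
Proof.
move=> kM; have := alternating_tail_bounds k (M - k).
rewrite (_ : ((M - k).+1 + k = M.+1)%N); last by lia.
rewrite -/(ztail true k M) => /andP[h0 h1].
have -> : `|ztail true k M| = `|sg true (M - k).+1 * ztail true k M|.
  by rewrite normrM norm_zsign mul1r.
by rewrite ger0_norm.
Qed.

(** A tail costs [k / (M - k + 1)]; one factor [1/k] of [c k] absorbs the [k], and what remains is a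
    term of the convolution at [M.+1]. *)
Lemma sum_ztail_le (c : nat -> R) C a M :
  (forall k, (0 < k)%N -> (k <= M)%N -> `|c k| <= C / k%:R ^+ 2) ->
  `|\sum_(1 <= k < M.+1) c k * ztail a k M| <= C * zconv R false false M.+1.
Proof.
move=> cC; apply: le_trans (ler_norm_sum _ _ _) _; rewrite mulr_sumr.
apply: ler_sum_nat => k /andP[k1 kM]; rewrite ltnS in kM.
rewrite normrM mul1r mul1r subSn //.
apply: le_trans (ler_pM _ _ (cC _ k1 kM) (norm_ztail_le a kM)) _ => //.
have k0 : 0 < k%:R :> R by rewrite ltr0n.
rewrite [leLHS](_ : _ = C * (k%:R * (M - k).+1%:R)^-1) //.
have m0 : 0 < (M - k).+1%:R :> R by rewrite ltr0n.
by move: (_.+1%:R : R) m0 => m m0; field; rewrite !gt_eqF.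
Qed.

(** Cancellation in a barred tail saves the factor [k], so coefficients of size [1/k] suffice. *)
Lemma sum_ztail_barred_le (c : nat -> R) M :
  (forall k, (0 < k)%N -> (k <= M)%N -> `|c k| <= k%:R^-1) ->
  `|\sum_(1 <= k < M.+1) c k * ztail true k M| <= zconv R false false M.+1.
Proof.
move=> cC; apply: le_trans (ler_norm_sum _ _ _) _.
apply: ler_sum_nat => k /andP[k1 kM]; rewrite ltnS in kM.
rewrite normrM mul1r mul1r subSn // invfM.
exact: ler_pM (cC _ k1 kM) (norm_ztail_barred_le kM).
Qed.

Lemma zconv_unbarredE M :
  zconv R false false M.+1 = 2 * (Z [:: (1, false)%N] M / M.+1%:R).
Proof. by rewrite zconvE /=; ring. Qed.

Lemma cvg_zconv0 : (fun M => zconv R false false M.+1) @ \oo --> (0 : R).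
Proof.
by apply: eq_cvgn (cvg0_scale 2 (ztrunc_ones_div_cvg0 1)) => M; rewrite zconv_unbarredE.
Qed.

(** The product is [2 H^2 / (M+1)] for the harmonic number [H] of [M]; stuffling [H^2] and bounding
    [1/n^2] by [1/n] reduces it to all-ones sums over [M+1]. *)
Lemma cvg_harmonic_zconv0 :
  (fun M => Z [:: (1, false)%N] M * zconv R false false M.+1) @ \oo --> (0 : R).
Proof.
apply: (@cvg0_dominated _ (fun M => 2 * (2 * (Z (nseq 2 (1, false)%N) M / M.+1%:R)
  + Z (nseq 1 (1, false)%N) M / M.+1%:R))); last first.
  apply: cvg0_scale; apply: cvg0_add; last exact: ztrunc_ones_div_cvg0.
  by apply: cvg0_scale; exact: ztrunc_ones_div_cvg0.
move=> M; rewrite zconv_unbarredE ger0_norm; last first.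
  by rewrite !mulr_ge0 ?divr_ge0 ?(ztrunc_ones_ge0 R 1).
rewrite mulrCA ler_pM2l ?ltr0n // !mulrA -mulrDl ler_pM2r ?invr_gt0 ?ltr0n //.
rewrite stuffle11 /letter_add /= mulr2n mulrDl !mul1r lerD2l !ztrunc1E.
apply: ler_sum_nat => n /andP[n1 _].
rewrite /zterm !mul1r (le_trans _ (@norm_zterm_le R (2, false)%N 1 n _ _)) //.
by rewrite /zterm mul1r ler_norm.
Qed.

Lemma cvg_zcorner_barred b : (fun M => zcorner R true b M) @ \oo --> (0 : R).
Proof.
apply: cvg0_dominated cvg_zconv0 => M; apply: sum_ztail_barred_le => k k1 _.
by rewrite normrM norm_zsign mul1r normfV normr_nat.
Qed.

End ErrorTerms.

(** * Asymptotics of the truncated sum formula *)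

Section SumFormula.
Variable R : realType.
Local Open Scope classical_set_scope.
Implicit Types (k m n M : nat) (x y z : nat * bool).
Notation sg := (@zsign R).
Notation Z := (@ztrunc R).
Notation zt := (@zterm R).
Variables (a b c : bool) (u : nat).

Lemma sum_fraction_split M :
  \sum_(1 <= i < u.+1) Z [:: (i, a); (1, b); (u.+1 - i, c)]%N M =
  \sum_(1 <= n < M.+1) \sum_(1 <= m < n) \sum_(1 <= k < m)
     sg a n * sg b m * sg c k / (m%:R * (n - k)%:R * k%:R ^+ u)
  - \sum_(1 <= n < M.+1) \sum_(1 <= m < n) \sum_(1 <= k < m)
     sg a n * sg b m * sg c k / (m%:R * (n - k)%:R * n%:R ^+ u).
Proof.
rewrite -sumrB; under eq_bigr do rewrite ztrunc3E.
rewrite exchange_big; apply: eq_big_nat => n /andP[n1 nM].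
rewrite -sumrB exchange_big; apply: eq_big_nat => m /andP[m1 mn].
rewrite -sumrB exchange_big; apply: eq_big_nat => k /andP[k1 km].
transitivity (sg a n * sg b m * sg c k / m%:R *
    (\sum_(1 <= i < u.+1) (n%:R ^+ i)^-1 * (k%:R ^+ (u.+1 - i))^-1)).
  by rewrite mulr_sumr; apply: eq_bigr => i _; rewrite /zterm /= expr1; ring.
rewrite sum_geometric_pair //; last by lia.
by rewrite natrB ?invfM; [ring | lia].
Qed.

Lemma sum_rev_shift (g : nat -> R) n m : (m < n)%N ->
  \sum_(1 <= k < m.+1) g (n - k)%N = \sum_(n - m <= r < n) g r.
Proof.
elim: m => [|m IH] mn; first by rewrite !big_geq // subn0.
rewrite big_nat_recr //= IH; last by lia.
rewrite addrC [RHS]big_ltn; last by lia.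
by rewrite (_ : (n - m.+1).+1 = (n - m)%N) //; lia.
Qed.

Lemma sum_fraction_outer M :
  \sum_(1 <= n < M.+1) \sum_(1 <= m < n) \sum_(1 <= k < m)
     sg a n * sg b m * sg c k / (m%:R * (n - k)%:R * n%:R ^+ u) =
  Z [:: (u, a (+) c); (1, b); (1, c)]%N M + Z [:: (u, a (+) c); (1, c); (1, b)]%N M
  + Z [:: (u, a (+) c); (2, b (+) c)]%N M - Z [:: (u, a (+) c); (1, c); (1, b (+) c)]%N M
  - Z [:: (u, a (+) c); (1, b); (1, b (+) c)]%N M
  - Z [:: (u.+1, a); (1, b (+) c)]%N M - Z [:: (u.+1, a (+) b (+) c); (1, b (+) c)]%N M.
Proof.
rewrite !(ztrunc_consE R (u, _)) !(ztrunc_consE R (u.+1, _)) -!big_split -!sumrB /=.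
apply: eq_big_nat => n /andP[n1 nM].
(* With [r = n - k], the condition [k < m] becomes [r + m > n]. The corner at [n.-1] has
   [r + m >= n], so the antidiagonal [r + m = n], which is [zconv], is removed. *)
transitivity (zt (u, a (+) c) n * (zcorner R c b n.-1 - zconv R c b n)); last first.
  rewrite zcornerE zconvE [c (+) b]addbC /zterm /= !zsign_addb exprS invfM.
  by case: (zsign_pm R b n) => ->; case: (zsign_pm R c n) => ->; ring.
rewrite /zcorner /zconv prednK // -sumrB mulr_sumr.
apply: eq_big_nat => m /andP[m1 mn].
transitivity (zt (u, a (+) c) n * (sg b m / m%:R *
    \sum_(1 <= k < m) sg c (n - k) / (n - k)%:R)).
  rewrite !mulr_sumr; apply: eq_big_nat => k /andP[k1 km].
  rewrite /zterm zsignB ?zsign_addb /= ?invfM; last by lia.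
  by case: (zsign_pm R c n) => ->; ring.
have := sum_rev_shift (fun r => sg c r / r%:R) mn; rewrite big_nat_recr //= => /eqP.
rewrite eq_sym -subr_eq => /eqP <-.
by rewrite (_ : (n.-1 - m).+1 = (n - m)%N); [rewrite invfM; ring | lia].
Qed.

Lemma sum_ztail_compl d k M : (k <= M)%N ->
  \sum_(1 <= q < (M - k).+1) sg d q / q%:R = Z [:: (1, d)%N] M - ztail R d k M.
Proof.
move=> kM; rewrite ztrunc1E (@big_cat_nat _ _ _ (M - k).+1 1 M.+1) //=; last by lia.
by rewrite addrK.
Qed.

Let F n m k : R := sg a n * sg b m * sg c k / (m%:R * (n - k)%:R * k%:R ^+ u).

(** Setting [n = k + q] decouples [q] from [m] and [k] except for [q <= M - k]; completing this
    range to [q <= M] gives the product and a [ztail] error. *)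
Lemma sum_fraction_square M :
  \sum_(1 <= k < M.+1) \sum_(k.+1 <= n < M.+1) \sum_(k.+1 <= m < M.+1) F n m k =
  Z [:: (1, a)%N] M * Z [:: (1, b); (u, a (+) c)]%N M
  - \sum_(1 <= k < M.+1) (zt (u, a (+) c) k * \sum_(k.+1 <= m < M.+1) zt (1, b)%N m)
       * ztail R a k M.
Proof.
rewrite ztrunc2E sum_triangle_swap mulr_sumr -sumrB.
apply: eq_big_nat => k /andP[k1 kM].
have -> : \sum_(k.+1 <= n < M.+1) zt (1, b)%N n * zt (u, a (+) c) k =
   zt (u, a (+) c) k * \sum_(k.+1 <= m < M.+1) zt (1, b)%N m.
  by rewrite mulr_sumr; apply: eq_bigr => m _; rewrite mulrC.
set S := \sum_(k.+1 <= m < M.+1) zt _ _.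
rewrite [Z _ M * _]mulrC -mulrBr -sum_ztail_compl // mulr_sumr.
rewrite -{1}[k.+1]add1n big_addn -subSn //; apply: eq_bigr => q _.
rewrite /S mulr_sumr mulr_suml; apply: eq_bigr => m _.
rewrite /F addnK /zterm /= zsign_addb zsignD expr1 !invfM.
by case: (zsign_pm R a k) => ->; ring.
Qed.

Lemma sum_fraction_inner M :
  \sum_(1 <= m < M.+1) \sum_(1 <= n < m) \sum_(1 <= k < n) F n m k =
  Z [:: (1, a (+) b)%N] M * Z [:: (1, b); (u, a (+) c)]%N M
  - Z [:: (u, a (+) c)] M * zcorner R (a (+) b) b M
  + \sum_(1 <= s < M.+1) (zt (1, b)%N s *
       (Z [:: (u, a (+) c)] M - Z [:: (u, a (+) c)] s.-1)) * ztail R (a (+) b) s M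
  - Z [:: (1, a (+) b); (1, a); (u, a (+) c)]%N M.
Proof.
rewrite (sum_mid_rev (fun m n k => F n m k)).
transitivity (\sum_(1 <= m < M.+1) \sum_(1 <= s < m)
    (sg (a (+) b) (m - s) / (m - s)%:R * zt (1, b)%N s * Z [:: (u, a (+) c)] s.-1)
  - Z [:: (1, a (+) b); (1, a); (u, a (+) c)]%N M).
  rewrite ztrunc3E -sumrB; apply: eq_big_nat => m /andP[m1 mM].
  rewrite -sumrB; apply: eq_big_nat => s /andP[s1 sm].
  rewrite ztrunc1E prednK // mulr_sumr -sumrB; apply: eq_big_nat => k /andP[k1 ks].
  (* After the reflection the denominator is [m (m - s) k^u], and
     [1/(m (m - s)) = (1/(m - s) - 1/m) / s] separates a convolution from a truncated triple sum. *)
  rewrite /F (_ : (m + k - s - k = m - s)%N); last by lia.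
  rewrite (_ : (m + k - s = m - s + k)%N); last by lia.
  rewrite /zterm /= zsignD !zsign_addb !zsignB; try by lia.
  rewrite natrB; last by lia.
  have s0 : s%:R != 0 :> R by rewrite pnatr_eq0 -lt0n.
  have m0 : m%:R != 0 :> R by rewrite pnatr_eq0 -lt0n.
  have k0 : k%:R ^+ u != 0 :> R by rewrite expf_neq0 // pnatr_eq0 -lt0n.
  have ms0 : m%:R - s%:R != 0 :> R by rewrite subr_eq0 eqr_nat; lia.
  rewrite !expr1; move: (m%:R : R) (s%:R : R) (k%:R ^+ u : R) s0 m0 k0 ms0 => m' s' K *.
  case: (zsign_pm R a k) => ->; case: (zsign_pm R a s) => ->;
  case: (zsign_pm R b s) => ->; by field; apply/and4P.
congr (_ - _).
have -> : \sum_(1 <= m < M.+1) \sum_(1 <= s < m)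
    (sg (a (+) b) (m - s) / (m - s)%:R * zt (1, b)%N s * Z [:: (u, a (+) c)] s.-1)
  = \sum_(1 <= s < M.+1) \sum_(1 <= r < (M - s).+1)
    (sg (a (+) b) r / r%:R * zt (1, b)%N s * Z [:: (u, a (+) c)] s.-1).
  exact: (sum_triangle_conv (fun s r =>
    sg (a (+) b) r / r%:R * zt (1, b)%N s * Z [:: (u, a (+) c)] s.-1)).
(* In the tail term the inner sum up to [s.-1] is replaced by the one up to [M], which splits off
   the corner; the remainder carries their difference, small in [s]. *)
rewrite (ztrunc_consE R (1%N, b)) /zcorner !mulr_sumr -sumrB -big_split.
apply: eq_big_nat => s /andP[s1 sM] /=.
rewrite -!mulr_suml sum_ztail_compl // -/(ztail R _ _ _) /zterm /= expr1; ring.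
Qed.

Lemma sum_fraction_diag M :
  \sum_(1 <= n < M.+1) \sum_(1 <= k < n) F n n k =
  Z [:: (u.+1, a (+) b (+) c)] M * Z [:: (1, a (+) b)%N] M
  - Z [:: (1, a (+) b); (u.+1, c)]%N M
  - \sum_(1 <= k < M.+1) zt (u.+1, a (+) b (+) c) k * ztail R (a (+) b) k M.
Proof.
(* Partial fractions [1/(n (n - k)) = (1/(n - k) - 1/n) / k]. *)
transitivity (\sum_(1 <= n < M.+1) \sum_(1 <= k < n)
    (zt (u.+1, a (+) b (+) c) k * (sg (a (+) b) (n - k) / (n - k)%:R))
  - Z [:: (1, a (+) b); (u.+1, c)]%N M).
  rewrite ztrunc2E -sumrB; apply: eq_big_nat => n /andP[n1 nM].
  rewrite -sumrB; apply: eq_big_nat => k /andP[k1 kn].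
  rewrite /F /zterm /= !zsign_addb !zsignB; try by lia.
  rewrite natrB; last by lia.
  have n0 : n%:R != 0 :> R by rewrite pnatr_eq0 -lt0n.
  have k0 : k%:R != 0 :> R by rewrite pnatr_eq0 -lt0n.
  have ku0 : k%:R ^+ u != 0 :> R by rewrite expf_neq0 // pnatr_eq0 -lt0n.
  have nk0 : n%:R - k%:R != 0 :> R by rewrite subr_eq0 eqr_nat; lia.
  rewrite expr1 exprS; move: (n%:R : R) (k%:R : R) (k%:R ^+ u : R) n0 k0 ku0 nk0 => n' k' K *.
  case: (zsign_pm R a k) => ->; case: (zsign_pm R b k) => ->; by field; apply/and4P.
rewrite [RHS]addrAC; congr (_ - _).
have -> : \sum_(1 <= n < M.+1) \sum_(1 <= k < n)
    (zt (u.+1, a (+) b (+) c) k * (sg (a (+) b) (n - k) / (n - k)%:R)) =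
  \sum_(1 <= k < M.+1) \sum_(1 <= q < (M - k).+1)
    (zt (u.+1, a (+) b (+) c) k * (sg (a (+) b) q / q%:R)).
  exact: (sum_triangle_conv (fun k q =>
    zt (u.+1, a (+) b (+) c) k * (sg (a (+) b) q / q%:R))).
rewrite (ztrunc1E R (u.+1, _)) mulr_suml -sumrB.
by apply: eq_big_nat => k /andP[k1 kM]; rewrite -mulr_sumr sum_ztail_compl //; ring.
Qed.

(* Limiting form of [sum_fraction_split]: square minus inner minus diagonal part,
   each without its vanishing tail, minus the outer part. *)
Definition sum_main M : R :=
  (Z [:: (1, a)%N] M * Z [:: (1, b); (u, a (+) c)]%N M
    - Z [:: (1, a (+) b)%N] M * Z [:: (1, b); (u, a (+) c)]%N M)
  + Z [:: (u, a (+) c)] M * zcorner R (a (+) b) b M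
  + Z [:: (1, a (+) b); (1, a); (u, a (+) c)]%N M
  - Z [:: (u.+1, a (+) b (+) c)] M * Z [:: (1, a (+) b)%N] M
  + Z [:: (1, a (+) b); (u.+1, c)]%N M
  - (Z [:: (u, a (+) c); (1, b); (1, c)]%N M + Z [:: (u, a (+) c); (1, c); (1, b)]%N M
  + Z [:: (u, a (+) c); (2, b (+) c)]%N M - Z [:: (u, a (+) c); (1, c); (1, b (+) c)]%N M
  - Z [:: (u, a (+) c); (1, b); (1, b (+) c)]%N M
  - Z [:: (u.+1, a); (1, b (+) c)]%N M - Z [:: (u.+1, a (+) b (+) c); (1, b (+) c)]%N M).

Lemma sum_inv_sqr_le s M : (0 < s)%N -> \sum_(s <= k < M) (k%:R ^+ 2)^-1 <= 2 / s%:R :> R.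
Proof.
move=> s0; have [Ms|sM] := leqP M s; first by rewrite big_geq // divr_ge0.
(* The added reciprocal makes the bound telescope in [d]. *)
suff h d : \sum_(s <= k < (s + d).+1) (k%:R ^+ 2)^-1 + (s + d)%:R^-1 <= 2 / s%:R :> R.
  have := h (M.-1 - s)%N; rewrite (_ : (s + (M.-1 - s)).+1 = M)%N; last by lia.
  by apply: le_trans; rewrite lerDl invr_ge0.
elim: d => [|d IH].
  rewrite addn0 big_nat1 mulrDl mul1r lerD2r lef_pV2 ?qualifE /= ?exprn_gt0 ?ltr0n //.
  by rewrite expr2 ler_peMr // ler1n.
apply: le_trans IH; rewrite addnS big_nat_recr /= -?addrA ?lerD2l; last by lia.
have N0 : 0 < (s + d)%:R :> R by rewrite ltr0n; lia.
rewrite -natr1; move: ((s + d)%:R : R) N0 => N N0.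
rewrite -subr_ge0 (_ : _ - _ = (N * (N + 1) ^+ 2)^-1).
  by rewrite invr_ge0 mulr_ge0 ?ltW // exprn_gt0 //; lra.
by field; rewrite !gt_eqF //; lra.
Qed.

(** Only the three sums against [ztail] separate the truncated sum from [sum_main]; each has
    coefficients of order [1/k^2], up to a harmonic factor in [E1]. *)
Lemma sum_formula_asymptotics : (1 < u)%N ->
  (fun M => \sum_(1 <= i < u.+1) Z [:: (i, a); (1, b); (u.+1 - i, c)]%N M - sum_main M)
    @ \oo --> (0 : R).
Proof.
move=> u2.
pose E1 M := \sum_(1 <= k < M.+1) (zt (u, a (+) c) k *
  \sum_(k.+1 <= m < M.+1) zt (1, b)%N m) * ztail R a k M.
pose E2 M := \sum_(1 <= s < M.+1) (zt (1, b)%N s *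
  (Z [:: (u, a (+) c)] M - Z [:: (u, a (+) c)] s.-1)) * ztail R (a (+) b) s M.
pose E3 M := \sum_(1 <= k < M.+1) zt (u.+1, a (+) b (+) c) k * ztail R (a (+) b) k M.
have E M : \sum_(1 <= i < u.+1) Z [:: (i, a); (1, b); (u.+1 - i, c)]%N M - sum_main M
    = E3 M + (-1) * (E1 M + E2 M).
  rewrite sum_fraction_split sum_fraction_outer /sum_main.
  have := sum_square_split F M.
  rewrite sum_fraction_square sum_fraction_inner sum_fraction_diag.
  rewrite -/(E1 M) -/(E2 M) -/(E3 M) => /eqP.
  by rewrite -addrA -subr_eq => /eqP <-; ring.
apply: eq_cvgn (fun M => esym (E M)) _.
apply: cvg0_add; last first.
  apply: cvg0_scale; apply: cvg0_add.
    (* In [E1] the sum over [m] is at most the harmonic number of [M], which serves as the constant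
       [C]. *)
    apply: cvg0_dominated (@cvg_harmonic_zconv0 R) => M; apply: sum_ztail_le => k k1 kM.
    rewrite normrM mulrC ler_pM ?norm_zterm_le //.
    apply: le_trans (ler_norm_sum _ _ _) _; rewrite ztrunc1E.
    rewrite (@big_cat_nat _ _ _ k.+1 1 M.+1) //=.
    rewrite -[leLHS]add0r lerD ?sumr_ge0 // => [m _|]; first exact: zterm_unbarred_ge0.
    apply: ler_sum_nat => m /andP[m1 _]; apply: le_trans (_ : (m%:R ^+ 1)^-1 <= _).
      by rewrite norm_zterm_le // (leq_trans _ m1).
    by rewrite /zterm mul1r.
  (* In [E2] the difference of the two sums is at most [2/s] by [sum_inv_sqr_le], whence [C = 2]. *)
  apply: cvg0_dominated (cvg0_scale 2 (@cvg_zconv0 R)) => M; apply: sum_ztail_le => s s1 sM.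
  rewrite normrM expr2 invfM mulrCA ler_pM //.
    by rewrite -[s%:R in leRHS]expr1 norm_zterm_le.
  rewrite !ztrunc1E (@big_cat_nat _ _ _ s 1 M.+1) //=; last by lia.
  rewrite prednK // addrAC subrr add0r; apply: le_trans (ler_norm_sum _ _ _) _.
  apply: le_trans (sum_inv_sqr_le M.+1 s1); apply: ler_sum_nat => k /andP[sk _].
  by rewrite norm_zterm_le // (leq_trans s1).
apply: cvg0_dominated (@cvg_zconv0 R) => M.
rewrite -[leRHS]mul1r; apply: sum_ztail_le => k k1 kM.
by rewrite mul1r norm_zterm_le // ltnW.
Qed.

End SumFormula.

(** * The eight evaluations *)

Section Evaluation.
Variable R : realType.
Local Open Scope classical_set_scope.
Notation Z := (@ztrunc R).

Lemma cvg_sum_nat (f : nat -> nat -> R) (l : nat -> R) m n :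
  (forall i, (m <= i < n)%N -> f i @ \oo --> l i) ->
  (fun M => \sum_(m <= i < n) f i M) @ \oo --> \sum_(m <= i < n) l i.
Proof.
elim: n => [|n IH] fl.
  rewrite big_geq //; apply: eq_cvgn (cvg_cst 0) => M.
  by rewrite big_geq.
have [mn|nm] := leqP m n; last first.
  rewrite big_geq //; apply: eq_cvgn (cvg_cst 0) => M.
  by rewrite big_geq.
rewrite big_nat_recr //=.
apply: (@eq_cvgn _ (fun M => \sum_(m <= i < n) f i M + f n M)).
  by move=> M; rewrite big_nat_recr.
apply: cvgD; last by apply: fl; lia.
by apply: IH => i /andP[mi ilt]; apply: fl; lia.
Qed.

Lemma cvg_lincomb (t : seq (R * eidx)) : all (fun p => admissible p.2) t ->
  (fun M => \sum_(p <- t) p.1 * Z p.2 M) @ \oo --> \sum_(p <- t) p.1 * zeta p.2.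
Proof.
elim: t => [_|p t IH /andP[padm tadm]].
  by rewrite big_nil; apply: eq_cvgn (cvg_cst 0) => M; rewrite big_nil.
rewrite big_cons; apply: (@eq_cvgn _ (fun M => p.1 * Z p.2 M + \sum_(p <- t) p.1 * Z p.2 M)).
  by move=> M; rewrite big_cons.
by apply: cvgD (IH tadm); exact: cvgM (cvg_cst _) (cvg_ztrunc padm).
Qed.

Lemma zeta_stuffle11 (x y : nat * bool) :
  admissible [:: x] -> admissible [:: y] -> admissible [:: letter_add x y] ->
  zeta [:: x] * zeta [:: y] =
    zeta [:: x; y] + zeta [:: y; x] + zeta [:: letter_add x y] :> R.
Proof.
rewrite /admissible /= !andbT => /andP[x1 xc] /andP[y1 yc] /andP[z1 zc].
apply: cvg_unique (cvgM (cvg_ztrunc _) (cvg_ztrunc _)) _ => //=.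
1, 2: by rewrite /admissible /= ?x1 ?y1.
apply: (@eq_cvgn _ (fun M => Z [:: x; y] M + Z [:: y; x] M + Z [:: letter_add x y] M)).
  by move=> M; rewrite -stuffle11.
by apply: cvgD; [apply: cvgD|]; apply: cvg_ztrunc; rewrite /admissible /= ?x1 ?y1 ?z1 ?xc ?yc.
Qed.

(** Reduces an evaluation to a limit of truncated sums; [t] lists the right-hand side as
    coefficients paired with indices. *)
Lemma sum_zeta_barred b c u (t : seq (R * eidx)) : (1 < u)%N ->
  all (fun p => admissible p.2) t ->
  (fun M => sum_main R true b c u M - \sum_(p <- t) p.1 * Z p.2 M) @ \oo --> (0 : R) ->
  \sum_(1 <= i < u.+1) (zeta [:: (i, true); (1, b); (u.+1 - i, c)]%N : R)%:P
    = (\sum_(p <- t) p.1 * zeta p.2)%:P.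
Proof.
move=> u2 /cvg_lincomb rl ml; rewrite -(rmorph_sum polyC); congr polyC.
have h1 : (fun M => \sum_(1 <= i < u.+1) Z [:: (i, true); (1, b); (u.+1 - i, c)]%N M)
    @ \oo --> \sum_(1 <= i < u.+1) (zeta [:: (i, true); (1, b); (u.+1 - i, c)]%N : R).
  by apply: cvg_sum_nat => i i1; apply: cvg_ztrunc; rewrite /admissible /=; lia.
apply/eqP; rewrite -subr_eq0; apply/eqP.
apply: cvg_unique (cvgB h1 rl) _ => //=.
apply: eq_cvgn (cvg0_add (sum_formula_asymptotics true b c u2) ml) => M.
by rewrite !fctE addrA subrK.
Qed.

(** The possibly divergent term [i = 1] is the same on both sides, as a polynomial and in truncated
    form, so it cancels before limits are taken. *)
Lemma sum_zstar_unbarred b c u (t : seq (R * eidx)) : (1 < u)%N ->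
  all (fun p => admissible p.2) t ->
  (fun M => sum_main R false b c u M - (Z [:: (1, false); (1, b); (u, c)]%N M
     + \sum_(p <- t) p.1 * Z p.2 M))
    @ \oo --> (0 : R) ->
  \sum_(1 <= i < u.+1) (zstar [:: (i, false); (1, b); (u.+1 - i, c)]%N : {poly R})
    = zstar [:: (1, false); (1, b); (u, c)]%N + (\sum_(p <- t) p.1 * zeta p.2)%:P.
Proof.
move=> u2 /cvg_lincomb rl ml; rewrite big_ltn; last by lia.
rewrite subSS subn0; congr (_ + _).
transitivity (\sum_(2 <= i < u.+1) (zeta [:: (i, false); (1, b); (u.+1 - i, c)]%N : R)%:P).
  by apply: eq_big_nat => i i2; rewrite zstar_admissible // /admissible /=; lia.
rewrite -(rmorph_sum polyC); congr polyC.
have h1 : (fun M => \sum_(2 <= i < u.+1) Z [:: (i, false); (1, b); (u.+1 - i, c)]%N M)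
    @ \oo --> \sum_(2 <= i < u.+1) (zeta [:: (i, false); (1, b); (u.+1 - i, c)]%N : R).
  by apply: cvg_sum_nat => i i2; apply: cvg_ztrunc; rewrite /admissible /=; lia.
apply/eqP; rewrite -subr_eq0; apply/eqP.
apply: cvg_unique (cvgB h1 rl) _ => //=.
apply: eq_cvgn (cvg0_add (sum_formula_asymptotics false b c u2) ml) => M.
rewrite !fctE addrA subrK [X in X - _]big_ltn; last by lia.
by rewrite subSS subn0; ring.
Qed.

Lemma cvg_ztrunc_zcorner0 s b : admissible s ->
  (fun M => Z s M * zcorner R true b M) @ \oo --> (0 : R).
Proof.
move=> sadm; rewrite -[X in _ --> X](mulr0 (zeta s : R)).
exact: cvgM (cvg_ztrunc sadm) (cvg_zcorner_barred b).
Qed.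

End Evaluation.

Ltac expand_lincomb := rewrite !big_cons !big_nil /= /unb /bar.

(** Once corners are expanded and all products stuffled, both sides are linear in truncated sums,
    which [ring] treats as atoms. *)
Ltac stuffle_ring :=
  expand_lincomb; rewrite /sum_main !zcornerE /= !(mulrDr, mulrN) ?stuffle12 ?stuffle11
    /letter_add /= ?(addn1, add1n, addn2, add2n); ring.

(* u = w - 2, v = w - 1; the sum is over a, c >= 1 with a + c = w - 1,
   i.e. a = 1, ..., w - 2 and c = w - 1 - a.  Convergent Euler sums zeta(s)
   are real numbers, viewed as constant polynomials via %:P. *)
Theorem theorem5p7 (R : realType) (w : nat) (hw : (4 <= w)%N) :
  let u := (w - 2)%N in let v := (w - 1)%N in
  (* 1 *)
  \sum_(1 <= a < v) zstar (R:=R) [:: unb a; unb 1; unb (v - a)]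
    = zstar (R:=R) [:: unb 1; unb 1; unb u] + (zeta (R:=R) [:: unb v; unb 1])%:P
      + (zeta (R:=R) [:: unb 2; unb u])%:P
  /\ (* 2 *)
  \sum_(1 <= a < v) zstar (R:=R) [:: unb a; bar 1; bar (v - a)]
    = zstar (R:=R) [:: unb 1; bar 1; bar u] + (zeta (R:=R) [:: bar 1; bar u; bar 1])%:P
      - (zeta (R:=R) [:: bar 1; bar u; unb 1])%:P + (zeta (R:=R) [:: unb v; bar 1])%:P
      + (zeta (R:=R) [:: bar 2; bar u])%:P
  /\ (* 3 *)
  \sum_(1 <= a < v) (zeta (R:=R) [:: bar a; bar 1; unb (v - a)] : R)%:P
    = (zeta (R:=R) [:: bar 1; bar 1; bar u])%:P + (zeta (R:=R) [:: unb 2; bar u])%:P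
      + (zeta (R:=R) [:: bar v; bar 1])%:P
  /\ (* 4 *)
  \sum_(1 <= a < v) (zeta (R:=R) [:: bar a; unb 1; bar (v - a)] : R)%:P
    = (zeta (R:=R) [:: bar 1; unb u; unb 1])%:P + (zeta (R:=R) [:: bar 1; unb 1; unb u])%:P
      - (zeta (R:=R) [:: bar 1; unb u; bar 1])%:P + (zeta (R:=R) [:: bar v; unb 1])%:P
      + (zeta (R:=R) [:: bar 2; unb u])%:P
  /\ (* 5 *)
  \sum_(1 <= a < v) (zeta (R:=R) [:: bar a; unb 1; unb (v - a)] : R)%:P
    = (zeta (R:=R) [:: bar 1; bar 1; bar u])%:P + 2%:R * (zeta (R:=R) [:: bar v; unb 1])%:P
      + (zeta (R:=R) [:: bar 1; unb v])%:P - (zeta (R:=R) [:: bar 1; bar v])%:P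
      - (zeta (R:=R) [:: bar v; bar 1])%:P - (zeta (R:=R) [:: bar u; unb 2])%:P
      - (zeta (R:=R) [:: unb w])%:P
  /\ (* 6 *)
  \sum_(1 <= a < v) zstar (R:=R) [:: unb a; unb 1; bar (v - a)]
    = (zeta (R:=R) [:: bar u; bar 1; bar 1])%:P - (zeta (R:=R) [:: bar u; bar 1; unb 1])%:P
      + zstar (R:=R) [:: unb 1; unb 1; bar u] - (zeta (R:=R) [:: bar v; bar 1])%:P
      + (zeta (R:=R) [:: unb v; bar 1])%:P + 2%:R * (zeta (R:=R) [:: bar v; bar 1])%:P
      - (zeta (R:=R) [:: bar v; unb 1])%:P
      - (zeta (R:=R) [:: bar u; bar 2])%:P
      + (zeta (R:=R) [:: unb 2] * zeta [:: bar u])%:P - (zeta (R:=R) [:: bar w])%:P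
  /\ (* 7 *)
  \sum_(1 <= a < v) zstar (R:=R) [:: unb a; bar 1; unb (v - a)]
    = 2%:R * (zeta (R:=R) [:: unb u; bar 1; bar 1])%:P
      - 2%:R * (zeta (R:=R) [:: unb u; bar 1; unb 1])%:P
      + (zeta (R:=R) [:: bar 1; unb 1; unb u])%:P + zstar (R:=R) [:: unb 1; bar 1; unb u]
      - (zeta (R:=R) [:: bar 1; bar 1; unb u])%:P + (zeta (R:=R) [:: bar v; bar 1])%:P
      + (zeta (R:=R) [:: unb v; bar 1])%:P
      + (zeta (R:=R) [:: bar 1; unb v])%:P - (zeta (R:=R) [:: bar v; unb 1])%:P
      - (zeta (R:=R) [:: bar 1; bar v])%:P - (zeta (R:=R) [:: unb 2; unb u])%:P
      - 2%:R * (zeta (R:=R) [:: unb u; bar 2])%:P - (zeta (R:=R) [:: bar w])%:P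
      - (zeta (R:=R) [:: unb w])%:P
  /\ (* 8 *)
  \sum_(1 <= a < v) (zeta (R:=R) [:: bar a; bar 1; bar (v - a)] : R)%:P
    = 3%:R * (zeta (R:=R) [:: unb u; bar 1; unb 1])%:P
      - 3%:R * (zeta (R:=R) [:: unb u; bar 1; bar 1])%:P
      + (zeta (R:=R) [:: bar 1; bar 1; unb u])%:P + 2%:R * (zeta (R:=R) [:: bar v; unb 1])%:P
      - (zeta (R:=R) [:: bar v; bar 1])%:P + (zeta (R:=R) [:: unb u; bar 2])%:P
      + (zeta (R:=R) [:: unb 2; unb u])%:P - (zeta (R:=R) [:: unb u; unb 2])%:P.
Proof.
(* From here [w = u.+2] and [v = u.+1]. *)
case: w hw => [|[|u]] // hw; have u2 : (1 < u)%N by [].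
rewrite /= !subSS !subn0.
have cvg0_eq (f : nat -> R) : (forall M, f M = 0) -> (f @ \oo --> (0 : R))%classic.
  by move=> f0; apply: eq_cvgn (cvg_cst 0) => M; rewrite f0.
split; [|split; [|split; [|split; [|split; [|split; [|split]]]]]].
- rewrite (sum_zstar_unbarred (t := [::
     (1, [:: unb u.+1; unb 1]); (1, [:: unb 2; unb u])])) //=;
    [|by rewrite /admissible /=; lia|].
    by expand_lincomb; rewrite !(polyCD, polyCN, polyCM); ring.
  by apply: cvg0_eq => M; stuffle_ring.
- rewrite (sum_zstar_unbarred (t := [::
     (1, [:: bar 1; bar u; bar 1]); (-1, [:: bar 1; bar u; unb 1]);
     (1, [:: unb u.+1; bar 1]); (1, [:: bar 2; bar u])])) //=;
    [|by rewrite /admissible /=; lia|].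
    by expand_lincomb; rewrite !(polyCD, polyCN, polyCM); ring.
  by apply: cvg0_eq => M; stuffle_ring.
- rewrite (sum_zeta_barred (t := [::
     (1, [:: bar 1; bar 1; bar u]); (1, [:: unb 2; bar u]); (1, [:: bar u.+1; bar 1])])) //=;
    [|by rewrite /admissible /=; lia|].
    by expand_lincomb; rewrite !(polyCD, polyCN, polyCM); ring.
  by apply: cvg0_eq => M; stuffle_ring.
- rewrite (sum_zeta_barred (t := [::
     (1, [:: bar 1; unb u; unb 1]); (1, [:: bar 1; unb 1; unb u]);
     (-1, [:: bar 1; unb u; bar 1]); (1, [:: bar u.+1; unb 1]);
     (1, [:: bar 2; unb u])])) //=;
    [|by rewrite /admissible /=; lia|].
    by expand_lincomb; rewrite !(polyCD, polyCN, polyCM); ring.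
  by apply: cvg0_eq => M; stuffle_ring.
- rewrite (sum_zeta_barred (t := [::
     (1, [:: bar 1; bar 1; bar u]); (2, [:: bar u.+1; unb 1]);
     (1, [:: bar 1; unb u.+1]); (-1, [:: bar 1; bar u.+1]);
     (-1, [:: bar u.+1; bar 1]); (-1, [:: bar u; unb 2]); (-1, [:: unb u.+2])])) //=;
    [|by rewrite /admissible /=; lia|].
    by expand_lincomb; rewrite !(polyCD, polyCN, polyCM); ring.
  (* The two sides differ at level [M] by the truncated [zeta(bar u)] times a barred corner, which
     vanishes in the limit. *)
  apply: eq_cvgn (cvg_ztrunc_zcorner0 false (s := [:: bar u]) _); last first.
    by rewrite /admissible /=; lia.
  by move=> M; stuffle_ring.
(* The last two entries come from stuffling [zeta(2) zeta(bar u)], whose merged term cancels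
   [- zeta(bar w)]. *)
- rewrite (sum_zstar_unbarred (t := [::
     (1, [:: bar u; bar 1; bar 1]); (-1, [:: bar u; bar 1; unb 1]);
     (-1, [:: bar u.+1; bar 1]); (1, [:: unb u.+1; bar 1]);
     (2, [:: bar u.+1; bar 1]); (-1, [:: bar u.+1; unb 1]); (-1, [:: bar u; bar 2]);
     (1, [:: unb 2; bar u]); (1, [:: bar u; unb 2])])) //=;
    [|by rewrite /admissible /=; lia|].
    rewrite zeta_stuffle11 /letter_add /= ?add2n ?/admissible /=; try by lia.
    by expand_lincomb; rewrite !(polyCD, polyCN, polyCM); ring.
  by apply: cvg0_eq => M; stuffle_ring.
- rewrite (sum_zstar_unbarred (t := [::
     (2, [:: unb u; bar 1; bar 1]); (-2, [:: unb u; bar 1; unb 1]);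
     (1, [:: bar 1; unb 1; unb u]); (-1, [:: bar 1; bar 1; unb u]);
     (1, [:: bar u.+1; bar 1]); (1, [:: unb u.+1; bar 1]); (1, [:: bar 1; unb u.+1]);
     (-1, [:: bar u.+1; unb 1]); (-1, [:: bar 1; bar u.+1]); (-1, [:: unb 2; unb u]);
     (-2, [:: unb u; bar 2]); (-1, [:: bar u.+2]); (-1, [:: unb u.+2])])) //=;
    [|by rewrite /admissible /=; lia|].
    by expand_lincomb; rewrite !(polyCD, polyCN, polyCM); ring.
  (* Here two barred corners, with second letter unbarred and barred, remain as multiples of the
     truncated [zeta(u)]. *)
  have h (d : bool) := @cvg_ztrunc_zcorner0 R [:: unb u] d.
  apply: eq_cvgn (cvg0_add (h false _) (h true _)); try by rewrite /admissible /=; lia.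
  by move=> M; stuffle_ring.
- rewrite (sum_zeta_barred (t := [::
     (3, [:: unb u; bar 1; unb 1]); (-3, [:: unb u; bar 1; bar 1]);
     (1, [:: bar 1; bar 1; unb u]); (2, [:: bar u.+1; unb 1]);
     (-1, [:: bar u.+1; bar 1]); (1, [:: unb u; bar 2]); (1, [:: unb 2; unb u]);
     (-1, [:: unb u; unb 2])])) //=;
    [|by rewrite /admissible /=; lia|].
    by expand_lincomb; rewrite !(polyCD, polyCN, polyCM); ring.
  by apply: cvg0_eq => M; stuffle_ring.
Qed.
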